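(* Let $\mathcal{WS}$ be the class of all weakly Stalnakerian selection frames and let $\mathcal{N}$ be the standard model of arithmetic. For every formula $\alpha$ in the (first-order) language of arithmetic, $\mathcal{N}\vDash\alpha$ if and only if $(\mathrm{AX}\to\alpha^* )\in\mathsf{L}(\mathcal{WS})$, where $\mathrm{AX}$ is the conjunction of (Ax1)–(Ax8) and $\alpha^*$ is the translation of $\alpha$, both defined in the context.
   Context: Language. There are countably many individual variables and, for each $n$, countably many $n$-place predicates. Formulas of $\mathcal{L}$: $\phi ::= P^n(x_1,\dots,x_n) \mid \neg\phi \mid (\phi\to\phi)\mid(\phi > \phi)\mid \forall x\,\phi$, where $>$ is a binary (conditional) connective; there is no identity symbol. $\wedge,\vee,\leftrightarrow,\top,\bot,\exists$ are defined as usual, and $\Diamond\phi:=\neg(\phi>\bot)$. Frames. A selection frame is $\mathcal{F}=\langle W,R,f,D,d\rangle$ where $W\neq\varnothing$ is a set (worlds), $R\subseteq W\times W$, $f:\mathcal{P}(W)\times W\to\mathcal{P}(W)$, $D\neq\varnothing$ is a set, $d:W\to\mathcal{P}(D)$ (local domains may be empty), and $f(P,w)\subseteq R(w):=\{x\in W\mid wRx\}$ for all $P\subseteq W$, $w\in W$. It is weakly Stalnakerian if for all $P,Q\subseteq W$, $w\in W$: $f(P,w)\subseteq P$; if $w\in P$ then $w\in f(P,w)$; if $f(P,w)\subseteq Q$ and $f(Q,w)\subseteq P$ then $f(P,w)=f(Q,w)$; and $|f(P,w)|\le 1$. Models. A model $\mathcal{M}$ based on $\mathcal{F}$ adds an interpretation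 $I$ with $I(P^n,w)\subseteq D^n$. A variable assignment $g$ maps variables into $D$; $g^x_a$ is $g$ changed to send $x$ to $a$. Satisfaction, with $[\phi]^g=\{w\in W\mid \mathcal{M},w,g\Vdash\phi\}$: $\mathcal{M},w,g\Vdash P^n(x_1,\dots,x_n)$ iff $\langle g(x_1),\dots,g(x_n)\rangle\in I(P^n,w)$; $\neg,\to$ are classical at each world; $\mathcal{M},w,g\Vdash\forall x\phi$ iff $\mathcal{M},w,g^x_a\Vdash\phi$ for all $a\in d(w)$; $\mathcal{M},w,g\Vdash\phi>\psi$ iff $f([\phi]^g,w)\subseteq[\psi]^g$. A formula is valid in a frame if it is satisfied in every model based on it, at every world, under every assignment; $\mathsf{L}(\mathcal{C})$ is the set of formulas valid in every frame of the class $\mathcal{C}$. Truth in $\mathcal{N}$. $\mathcal{N}\vDash\alpha$ means that $\alpha$ is satisfied in $\mathcal{N}$ under every variable assignment on $\omega$. Abbreviations. Fix a monadic predicate $F$ and two 3-place predicates $A$, $M$. Put $N(x):=\Diamond F(x)$; $x<y:=N(x)\wedge N(y)\wedge((F(x)\vee F(y))>\neg F(y))$; $x\equiv y:=N(x)\wedge N(y)\wedge((F(x)\vee F(y))>(F(x)\wedge F(y)))$; $Z(x):=N(x)\wedge\neg\exists y(y<x)$; $S(x,y):=x<y\wedge\neg\exists z(x<z\wedge z<y)$. Axioms. (Ax1) $\exists x\,N(x)$. (Ax2) $\forall x(N(x)\to\exists y\,S(x,y))$. (Ax3) $\forall x((N(x)\wedge\neg Z(x))\to\exists y\,S(y,x))$.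 (Ax4) $\forall x_1x_2x_3\forall y_1y_2y_3((x_1\equiv y_1\wedge x_2\equiv y_2\wedge x_3\equiv y_3)\to((A(x_1,x_2,x_3)\leftrightarrow A(y_1,y_2,y_3))\wedge(M(x_1,x_2,x_3)\leftrightarrow M(y_1,y_2,y_3))))$. (Ax5) $\forall xyzz'(((A(x,y,z)\wedge A(x,y,z'))\to z\equiv z')\wedge((M(x,y,z)\wedge M(x,y,z'))\to z\equiv z'))$. (Ax6) $\forall xy((N(x)\wedge Z(y))\to(A(x,y,x)\wedge M(x,y,y)))$. (Ax7) $\forall xyy'zz'((S(y,y')\wedge S(z,z'))\to(A(x,y,z)\to A(x,y',z')))$. (Ax8) $\forall xyy'zu((S(y,y')\wedge A(z,x,u))\to(M(x,y,z)\to M(x,y',u)))$. Translation. The language of arithmetic has $0$, successor $s$, $+$, $\times$, $<$, $=$ and the same variables. $\alpha^*$ is the standard translation of $\alpha$ into the abbreviations above, with quantifiers restricted to $N$: $=$ between variables becomes $\equiv$, $<$ becomes the abbreviation $<$, and the graphs of $0,s,+,\times$ become $Z,S,A,M$. Explicitly (with $u,v$ fresh): $(x=y)^*:=x\equiv y$; $(0=y)^*:=Z(y)$; $(s(t)=y)^*:=\exists u(N(u)\wedge(t=u)^*\wedge S(u,y))$; $(t_1+t_2=y)^*:=\exists u\exists v(N(u)\wedge N(v)\wedge(t_1=u)^*\wedge(t_2=v)^*\wedge A(u,v,y))$; $(t_1\times t_2=y)^*$ likewise with $M$; for other equations $(t_1=t_2)^*:=\exists u(N(u)\wedge(t_1=u)^*\wedge(t_2=u)^*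 )$; $(t_1<t_2)^*:=\exists u\exists v(N(u)\wedge N(v)\wedge(t_1=u)^*\wedge(t_2=v)^*\wedge u<v)$; $*$ commutes with $\neg,\to$; $(\forall x\,\beta)^*:=\forall x(N(x)\to\beta^* )$.
   Formalization: For open α the left-to-right direction is false (α := x=x, with x denoting a non-N individual); the formal theorem proves the equivalence with α replaced by its universal closure, the literal equivalence for sentences α, and the literal right-to-left direction for all α. *)

(* Defs.v *)
From mathcomp Require Import all_boot.
From mathcomp Require Import boolp classical_sets.

Set Implicit Arguments.
Unset Strict Implicit.
Unset Printing Implicit Defensive.

Local Open Scope classical_set_scope.

Definition var : Type := nat.

Definition update (D : Type) (g : var -> D) (x : var) (a : D) : var -> D :=
  fun y => if y == x then a else g y.

(** * The language L of quantified conditional logic *)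

(** [FPred n i v] is the [i]-th [n]-place predicate applied to the variables [v]. *)
Inductive formula : Type :=
| FPred (n i : nat) (v : n.-tuple var)
| FNeg of formula
| FImp of formula & formula
| FCond of formula & formula
| FAll of var & formula.

Declare Scope cond_scope.
Delimit Scope cond_scope with cond.
Bind Scope cond_scope with formula.

Definition FAnd (p q : formula) : formula := FNeg (FImp p (FNeg q)).
Definition FOr (p q : formula) : formula := FImp (FNeg p) q.
Definition FIff (p q : formula) : formula := FAnd (FImp p q) (FImp q p).
Definition FEx (x : var) (p : formula) : formula := FNeg (FAll x (FNeg p)).

Notation "¬ p" := (FNeg p) (at level 75, right associativity) : cond_scope.
Notation "p ∧ q" := (FAnd p q) (at level 80, right associativity) : cond_scope.
Notation "p ∨ q" := (FOr p q) (at level 85, right associativity) : cond_scope.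
Notation "p ▷ q" := (FCond p q) (at level 90, no associativity) : cond_scope.
Notation "p → q" := (FImp p q) (at level 99, right associativity) : cond_scope.
Notation "p ↔ q" := (FIff p q) (at level 95, no associativity) : cond_scope.
Notation "∀ x , p" := (FAll x p)
  (at level 200, x at level 30, p at level 200, right associativity) : cond_scope.
Notation "∃ x , p" := (FEx x p)
  (at level 200, x at level 30, p at level 200, right associativity) : cond_scope.

Local Open Scope cond_scope.

(** A closed tautology; it is true at every world, also if the local domain is empty. *)
Definition FTop : formula := ∀ 0, (FPred 0 [tuple 0] → FPred 0 [tuple 0]).
Definition FBot : formula := ¬ FTop.
Definition FDia (p : formula) : formula := ¬ (p ▷ FBot).

(** * Selection frames and models *)

Record selection_frame : Type := SelectionFrame {
  world : Type;
  acc : world -> world -> Prop;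
  sel : set world -> world -> set world;
  dom : Type;
  ldom : world -> set dom;
  world_inhabited : inhabited world;
  dom_inhabited : inhabited dom;
  sel_acc : forall P w, sel P w `<=` [set x | acc w x]
}.

Definition weakly_stalnakerian : set selection_frame := [set Fr |
  forall (P Q : set (world Fr)) (w : world Fr),
    [/\ sel P w `<=` P,
        P w -> sel P w w,
        sel P w `<=` Q -> sel Q w `<=` P -> sel P w = sel Q w
      & is_subset1 (sel P w)]].

(** [I n i w] is the extension at [w] of the [i]-th [n]-place predicate. *)
Definition interpretation (Fr : selection_frame) : Type :=
  forall n : nat, nat -> world Fr -> set (n.-tuple (dom Fr)).

Fixpoint sat (Fr : selection_frame) (I : interpretation Fr)
    (p : formula) (w : world Fr) (g : var -> dom Fr) {struct p} : Prop :=
  match p with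
  | FPred n i v => I n i w (map_tuple g v)
  | FNeg q => ~ sat I q w g
  | FImp q r => sat I q w g -> sat I r w g
  | FCond q r => sel [set u | sat I q u g] w `<=` [set u | sat I r u g]
  | FAll x q => forall a, ldom w a -> sat I q w (update g x a)
  end.

Definition valid (Fr : selection_frame) (p : formula) : Prop :=
  forall (I : interpretation Fr) (w : world Fr) (g : var -> dom Fr), sat I p w g.

Definition logic (C : set selection_frame) : set formula :=
  [set p | forall Fr, C Fr -> valid Fr p].

(** * Arithmetical abbreviations in L *)

(** A variable different from all variables in [s]. *)
Definition fresh (s : seq var) : var := (foldr maxn 0 s).+1.

Definition Ff (x : var) : formula := FPred 0 [tuple x].
Definition Af (x y z : var) : formula := FPred 0 [tuple x; y; z].
Definition Mf (x y z : var) : formula := FPred 1 [tuple x; y; z].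

Definition Nf (x : var) : formula := FDia (Ff x).

Definition Ltf (x y : var) : formula :=
  Nf x ∧ Nf y ∧ ((Ff x ∨ Ff y) ▷ ¬ Ff y).

Definition Eqf (x y : var) : formula :=
  Nf x ∧ Nf y ∧ ((Ff x ∨ Ff y) ▷ (Ff x ∧ Ff y)).

Definition Zf (x : var) : formula :=
  let y := fresh [:: x] in Nf x ∧ ¬ (∃ y, Ltf y x).

Definition Sf (x y : var) : formula :=
  let z := fresh [:: x; y] in Ltf x y ∧ ¬ (∃ z, (Ltf x z ∧ Ltf z y)).

Definition Ax1 : formula := let x := 0 in ∃ x, Nf x.

Definition Ax2 : formula :=
  let x := 0 in let y := 1 in ∀ x, (Nf x → ∃ y, Sf x y).

Definition Ax3 : formula :=
  let x := 0 in let y := 1 in ∀ x, ((Nf x ∧ ¬ Zf x) → ∃ y, Sf y x).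

Definition Ax4 : formula :=
  let x1 := 0 in let x2 := 1 in let x3 := 2 in
  let y1 := 3 in let y2 := 4 in let y3 := 5 in
  ∀ x1, ∀ x2, ∀ x3, ∀ y1, ∀ y2, ∀ y3,
    ((Eqf x1 y1 ∧ Eqf x2 y2 ∧ Eqf x3 y3) →
     ((Af x1 x2 x3 ↔ Af y1 y2 y3) ∧ (Mf x1 x2 x3 ↔ Mf y1 y2 y3))).

Definition Ax5 : formula :=
  let x := 0 in let y := 1 in let z := 2 in let z' := 3 in
  ∀ x, ∀ y, ∀ z, ∀ z',
    (((Af x y z ∧ Af x y z') → Eqf z z') ∧ ((Mf x y z ∧ Mf x y z') → Eqf z z')).

Definition Ax6 : formula :=
  let x := 0 in let y := 1 in
  ∀ x, ∀ y, ((Nf x ∧ Zf y) → (Af x y x ∧ Mf x y y)).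

Definition Ax7 : formula :=
  let x := 0 in let y := 1 in let y' := 2 in let z := 3 in let z' := 4 in
  ∀ x, ∀ y, ∀ y', ∀ z, ∀ z',
    ((Sf y y' ∧ Sf z z') → (Af x y z → Af x y' z')).

Definition Ax8 : formula :=
  let x := 0 in let y := 1 in let y' := 2 in let z := 3 in let u := 4 in
  ∀ x, ∀ y, ∀ y', ∀ z, ∀ u,
    ((Sf y y' ∧ Af z x u) → (Mf x y z → Mf x y' u)).

Definition AX : formula :=
  Ax1 ∧ Ax2 ∧ Ax3 ∧ Ax4 ∧ Ax5 ∧ Ax6 ∧ Ax7 ∧ Ax8.

(** * First-order arithmetic *)

Inductive term : Type :=
| TVar of var
| TZero
| TSucc of term
| TAdd of term & term
| TMul of term & term.

Inductive aformula : Type :=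
| AEq of term & term
| ALt of term & term
| ANeg of aformula
| AImp of aformula & aformula
| AAll of var & aformula.

Fixpoint teval (g : var -> nat) (t : term) : nat :=
  match t with
  | TVar x => g x
  | TZero => 0
  | TSucc t1 => (teval g t1).+1
  | TAdd t1 t2 => teval g t1 + teval g t2
  | TMul t1 t2 => teval g t1 * teval g t2
  end.

Fixpoint asat (g : var -> nat) (a : aformula) : Prop :=
  match a with
  | AEq t1 t2 => teval g t1 = teval g t2
  | ALt t1 t2 => teval g t1 < teval g t2
  | ANeg b => ~ asat g b
  | AImp b c => asat g b -> asat g c
  | AAll x b => forall n : nat, asat (update g x n) b
  end.

Definition true_in_N (a : aformula) : Prop := forall g : var -> nat, asat g a.

Fixpoint tvars (t : term) : seq var :=
  match t with
  | TVar x => [:: x]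
  | TZero => [::]
  | TSucc t1 => tvars t1
  | TAdd t1 t2 | TMul t1 t2 => tvars t1 ++ tvars t2
  end.

Fixpoint free_vars (a : aformula) : seq var :=
  match a with
  | AEq t1 t2 | ALt t1 t2 => tvars t1 ++ tvars t2
  | ANeg b => free_vars b
  | AImp b c => free_vars b ++ free_vars c
  | AAll x b => [seq y <- free_vars b | y != x]
  end.

Definition sentence (a : aformula) : Prop := free_vars a = [::].

(** In L a free variable may denote an individual that is not in the local domain or does
    not satisfy [Nf], so the translation of an open formula does not express the truth of the
    formula under all assignments; that of its universal closure does. A sentence is its own
    universal closure. *)
Definition universal_closure (a : aformula) : aformula :=
  foldr AAll a (undup (free_vars a)).

(** * The translation *)

(** [eq_var_star t y] is the translation of the equation [t = y], [y] a variable. *)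
Fixpoint eq_var_star (t : term) (y : var) : formula :=
  match t with
  | TVar x => Eqf x y
  | TZero => Zf y
  | TSucc t1 =>
      let u := fresh (y :: tvars t1) in
      ∃ u, (Nf u ∧ eq_var_star t1 u ∧ Sf u y)
  | TAdd t1 t2 =>
      let u := fresh (y :: tvars t1 ++ tvars t2) in
      let v := fresh (u :: y :: tvars t1 ++ tvars t2) in
      ∃ u, ∃ v,
        (Nf u ∧ Nf v ∧ eq_var_star t1 u ∧ eq_var_star t2 v ∧ Af u v y)
  | TMul t1 t2 =>
      let u := fresh (y :: tvars t1 ++ tvars t2) in
      let v := fresh (u :: y :: tvars t1 ++ tvars t2) in
      ∃ u, ∃ v,
        (Nf u ∧ Nf v ∧ eq_var_star t1 u ∧ eq_var_star t2 v ∧ Mf u v y)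
  end.

Definition eq_star (t1 t2 : term) : formula :=
  match t2 with
  | TVar y => eq_var_star t1 y
  | _ =>
      let u := fresh (tvars t1 ++ tvars t2) in
      ∃ u, (Nf u ∧ eq_var_star t1 u ∧ eq_var_star t2 u)
  end.

Definition lt_star (t1 t2 : term) : formula :=
  let u := fresh (tvars t1 ++ tvars t2) in
  let v := fresh (u :: tvars t1 ++ tvars t2) in
  ∃ u, ∃ v,
    (Nf u ∧ Nf v ∧ eq_var_star t1 u ∧ eq_var_star t2 v ∧ Ltf u v).

Fixpoint star (a : aformula) : formula :=
  match a with
  | AEq t1 t2 => eq_star t1 t2
  | ALt t1 t2 => lt_star t1 t2
  | ANeg b => ¬ star b
  | AImp b c => star b → star c
  | AAll x b => ∀ x, (Nf x → star b)
  end.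

(* Main.v *)
Require Import Defs.
From mathcomp Require Import all_boot.
From mathcomp Require Import boolp classical_sets.

(** Call an individual of the local domain of [w] natural if [Nf] holds of it at [w], and let
    [a] weakly precede [b] if the world selected at [w] by [ext a `|` ext b] lies in [ext a].
    Weak Stalnakerianness makes this a total preorder on the naturals; it is well-founded, since
    the selection function is also defined at unions of infinitely many extensions.
    Hence (Ax1)-(Ax3) give it order type omega and (Ax4)-(Ax8) determine addition and
    multiplication by recursion, so at every world satisfying AX the translation of a sentence is true iff the sentence
    holds in the standard model. Conversely, let the worlds and the individuals be the natural
    numbers, let [F n] hold at [n] only, and let a proposition select the least world in it (or
    the world of evaluation, if it is in it): at world 0 the precedence is the usual order. *)

Set Implicit Arguments.
Unset Strict Implicit.
Unset Printing Implicit Defensive.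

Local Open Scope classical_set_scope.

(** * Preorders of order type omega *)

Definition immediate_succ (T : Type) (X : set T) (le : T -> T -> Prop) (a b : T) : Prop :=
  ~ le b a /\ ~ exists2 c, X c & ~ le c a /\ ~ le b c.

(** The rank counts immediate-successor steps from the minimal elements. Every element gets a rank:
    a least one without rank would not be minimal, and its immediate predecessor, lying strictly
    below, would have a rank. As [le] need not be antisymmetric, [h] may identify elements. *)
Lemma omega_rank (T : Type) (X : set T) (le : T -> T -> Prop) :
  (forall a b, X a -> X b -> le a b \/ le b a) ->
  (forall b a c, X a -> X b -> X c -> le a b -> le b c -> le a c) ->
  (forall Y : set T, Y `<=` X -> Y !=set0 -> exists2 a, Y a & forall b, Y b -> le a b) ->
  X !=set0 ->
  (forall a, X a -> exists2 b, X b & immediate_succ X le a b) ->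
  (forall a, X a -> (exists2 b, X b & ~ le a b) ->
     exists2 b, X b & immediate_succ X le b a) ->
  exists h : T -> nat, (forall n, exists2 a, X a & h a = n) /\
    forall a b, X a -> X b -> (le a b <-> h a <= h b).
Proof.
move=> le_total le_trans le_wf X0 X_succ X_pred.
(* [level n] is the [n]-th equivalence class: level 0 holds the minimal elements, level [n.+1] the
   immediate successors of members of level [n]. *)
pose fix level n : set T := if n is m.+1
  then [set a | X a /\ exists2 b, level m b & immediate_succ X le b a]
  else [set a | X a /\ forall b, X b -> le a b].
have levelX n a : level n a -> X a by case: n => [|k] [].
have level_eq n a b : level n a -> level n b -> le a b.
  elim: n a b => [|n IHn] a b /=; first by move=> [Xa aP] [Xb _]; exact: aP.
  move=> [Xa [c lc [_ no_between]]] [Xb [d ld [nbd _]]].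
  have [Xc Xd] := (levelX _ _ lc, levelX _ _ ld).
  (* Otherwise [b] would lie strictly between [c] and its immediate successor [a]. *)
  apply: contrapT => nab; apply: no_between; exists b => //; split=> // bc.
  by apply: nbd; apply: (le_trans c) => //; exact: IHn.
have level_lt n m a b : n < m -> level n a -> level m b -> ~ le b a.
  elim: m b => // m IHm b; rewrite ltnS leq_eqVlt => nm la [Xb [c lc [nbc _]]] ba.
  have [Xa Xc] := (levelX _ _ la, levelX _ _ lc); apply: nbc.
  apply: (le_trans a) => //; case/orP: nm => [/eqP nm|nm].
    by rewrite nm in la; exact: (level_eq m).
  by case: (le_total a c Xa Xc) => // ca; case: (IHm c nm la lc ca).
have level_total a : X a -> exists n, level n a.
  move=> Xa; apply: contrapT => na.
  have [||b [Xb nb] bP] := le_wf [set b | X b /\ ~ exists n, level n b].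
  - by move=> b [].
  - by exists a.
  have [c Xc [nbc ncb]] : exists2 c, X c & immediate_succ X le c b.
    apply: X_pred => //; apply: contrapT => bmin; apply: nb; exists 0; split=> // c Xc.
    by apply: contrapT => nbc; apply: bmin; exists c.
  apply: (nbc); apply: bP; split=> // -[n lc]; apply: nb; exists n.+1.
  by split=> //; exists c.
have level_nonempty n : exists a, level n a.
  elim: n => [|n [a la]].
    by have [a Xa aP] := le_wf X (fun _ => id) X0; exists a.
  have [b Xb ab] := X_succ a (levelX _ _ la).
  by exists b; split=> //; exists a.
(* Outside [X] the rank takes the default value 0. *)
have /choice[h hP] a : exists n, X a -> level n a.
  have [Xa|nXa] := pselect (X a); last by exists 0.
  by have [n] := level_total a Xa; exists n.
exists h; split=> [n|a b Xa Xb].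
  have [a la] := level_nonempty n; have Xa := levelX _ _ la; exists a => //.
  (* Were [a] on two different levels, it would strictly precede itself, against the reflexivity
     contained in totality. *)
  have [||//] := ltngtP (h a) n => /level_lt.
    by move=> /(_ _ _ (hP a Xa) la); case: (le_total a a Xa Xa).
  by move=> /(_ _ _ la (hP a Xa)); case: (le_total a a Xa Xa).
have [la lb] := (hP a Xa, hP b Xb); split=> [ab|].
  by rewrite leqNgt; apply/negP => /level_lt/(_ lb la).
rewrite leq_eqVlt => /orP[/eqP hab|hab]; first by rewrite -hab in lb; exact: (level_eq (h a)).
by case: (le_total a b Xa Xb) => // /(level_lt _ _ _ _ hab la lb).
Qed.

(** * Updated assignments and fresh variables *)

Lemma update_same (D : Type) (g : var -> D) x (a : D) : update g x a x = a.
Proof. by rewrite /update eqxx. Qed.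

Lemma update_other (D : Type) (g : var -> D) x y (a : D) : y != x -> update g x a y = g y.
Proof. by rewrite /update => /negPf ->. Qed.

Lemma ltn_fresh s x : x \in s -> x < fresh s.
Proof.
elim: s => //= y s IHs; rewrite inE ltnS => /orP[/eqP->|/IHs]; first exact: leq_maxl.
by rewrite ltnS => /leq_trans; apply; exact: leq_maxr.
Qed.

Lemma update_fresh (D : Type) (g : var -> D) s (a : D) x :
  x \in s -> update g (fresh s) a x = g x.
Proof. by move=> /ltn_fresh xs; rewrite update_other// neq_ltn xs. Qed.

(** * Satisfaction of the connectives and of the abbreviations *)

Section Semantics.
Variables (Fr : selection_frame) (I : interpretation Fr).
Implicit Types (w : world Fr) (g : var -> dom Fr) (p q : formula) (a b c : dom Fr).

Lemma sat_FImp p q w g : sat I (FImp p q) w g = (sat I p w g -> sat I q w g).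
Proof. by []. Qed.

Lemma sat_FNeg p w g : sat I (FNeg p) w g = ~ sat I p w g.
Proof. by []. Qed.

Lemma sat_FAnd p q w g : sat I (FAnd p q) w g = (sat I p w g /\ sat I q w g).
Proof.
apply/propext; split=> /= [H|[pw qw] H]; last exact: H.
by split; apply: contrapT => H'; apply: H.
Qed.

Lemma sat_FOr p q w g : sat I (FOr p q) w g = (sat I p w g \/ sat I q w g).
Proof.
apply/propext; split=> /= [H|[pw|qw] //].
by have [|/H] := pselect (sat I p w g); [left|right].
Qed.

Lemma sat_FIff p q w g : sat I (FIff p q) w g = (sat I p w g <-> sat I q w g).
Proof. by rewrite sat_FAnd. Qed.

Lemma sat_FEx x p w g :
  sat I (FEx x p) w g = exists2 a, ldom w a & sat I p w (update g x a).
Proof.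
apply/propext; split=> /= [H|[a da pa] H]; last exact: (H a).
by apply: contrapT => H'; apply: H => a da pa; apply: H'; exists a.
Qed.

Lemma sat_FAllE x p w g a :
  ldom w a -> sat I (FAll x p) w g -> sat I p w (update g x a).
Proof. by move=> da /(_ a da). Qed.

Lemma sat_FAllI x p w g :
  (forall a, ldom w a -> sat I p w (update g x a)) -> sat I (FAll x p) w g.
Proof. by []. Qed.

Definition ext a : set (world Fr) := [set u | I 0 u [tuple a]].

Definition possible w a : Prop := sel (ext a) w !=set0.

Definition natural w : set (dom Fr) := [set a | ldom w a /\ possible w a].

Definition precedes w a b : Prop :=
  [/\ possible w a, possible w b & sel (ext a `|` ext b) w `<=` ~` ext b].

Definition equivalent w a b : Prop :=
  [/\ possible w a, possible w b & sel (ext a `|` ext b) w `<=` ext a `&` ext b].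

(** Here and in [successor] the bound individual ranges over [ldom w], as the quantifiers of the
    language do. This amounts to ranging over [natural w], since [precedes] entails [possible] of
    both arguments. *)
Definition initial w a : Prop :=
  possible w a /\ ~ exists2 b, ldom w b & precedes w b a.

Definition successor w a b : Prop :=
  precedes w a b /\ ~ exists2 c, ldom w c & precedes w a c /\ precedes w c b.

Definition addition w a b c : Prop := I 0 w [tuple a; b; c].
Definition multiplication w a b c : Prop := I 1 w [tuple a; b; c].

Lemma sat_Ff x w g : sat I (Ff x) w g = ext (g x) w.
Proof. by rewrite /= /ext /=; congr (I 0 w _); exact: val_inj. Qed.

Lemma sat_Af x y z w g : sat I (Af x y z) w g = addition w (g x) (g y) (g z).
Proof. by congr (I 0 w _); exact: val_inj. Qed.

Lemma sat_Mf x y z w g : sat I (Mf x y z) w g = multiplication w (g x) (g y) (g z).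
Proof. by congr (I 1 w _); exact: val_inj. Qed.

Lemma sat_Nf x w g : sat I (Nf x) w g = possible w (g x).
Proof.
rewrite /Nf /FDia sat_FNeg /=.
have -> : [set u | sat I (Ff x) u g] = ext (g x) by apply/funext => u; exact: sat_Ff.
(* [FBot] fails at every world, even with an empty local domain, so a selection is included in it
   only if it is empty. *)
apply/propext; split=> [H|[u fu] /(_ u fu) H]; last by apply: H => a _.
by apply: contrapT => H'; apply: H => u fu; case: H'; exists u.
Qed.

Lemma sat_FOrFf x y g :
  [set u | sat I (FOr (Ff x) (Ff y)) u g] = ext (g x) `|` ext (g y).
Proof. by apply/funext => u; rewrite /mkset sat_FOr !sat_Ff. Qed.

Lemma sat_Ltf x y w g : sat I (Ltf x y) w g = precedes w (g x) (g y).
Proof.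
rewrite /Ltf !sat_FAnd !sat_Nf [sat _ (FCond _ _) _ _]/sat -/sat sat_FOrFf.
have -> : [set u | ~ sat I (Ff y) u g] = ~` ext (g y).
  by apply/funext => u; rewrite /mkset sat_Ff.
by apply/propext; split=> [[? []]|[]].
Qed.

Lemma sat_Eqf x y w g : sat I (Eqf x y) w g = equivalent w (g x) (g y).
Proof.
rewrite /Eqf !sat_FAnd !sat_Nf [sat _ (FCond _ _) _ _]/sat -/sat sat_FOrFf.
have -> : [set u | sat I (FAnd (Ff x) (Ff y)) u g] = ext (g x) `&` ext (g y).
  by apply/funext => u; rewrite /mkset sat_FAnd !sat_Ff.
by apply/propext; split=> [[? []]|[]].
Qed.

Lemma sat_Zf x w g : sat I (Zf x) w g = initial w (g x).
Proof.
rewrite /Zf sat_FAnd sat_FNeg sat_FEx sat_Nf; congr (_ /\ ~ _).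
by congr ex2; apply/funext => b; rewrite sat_Ltf update_same update_fresh ?inE.
Qed.

Lemma sat_Sf x y w g : sat I (Sf x y) w g = successor w (g x) (g y).
Proof.
rewrite /Sf sat_FAnd sat_FNeg sat_FEx sat_Ltf; congr (_ /\ ~ _).
congr ex2; apply/funext => b.
by rewrite sat_FAnd !sat_Ltf update_same !update_fresh ?inE ?eqxx ?orbT.
Qed.

(* The order matters: [FAnd], [FEx] and the abbreviations are convertible to instances of [FNeg]. *)
Definition satE :=
  (sat_Ltf, sat_Eqf, sat_Zf, sat_Sf, sat_Nf, sat_Af, sat_Mf,
   sat_FIff, sat_FAnd, sat_FEx, sat_FNeg, sat_FImp).

(** * Naturals at a world and their codes *)

Lemma natural_successor w a b : ldom w b -> successor w a b -> natural w b.
Proof. by move=> db [[_ pb _] _]; split. Qed.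

(** Several individuals may share a code: the language has no identity symbol, so equality of codes
    is matched with [equivalent]. The clauses constrain [h] on [natural w] only. *)
Record order_coding w (h : dom Fr -> nat) : Prop := OrderCoding {
  coding_surj : forall n, exists2 a, natural w a & h a = n;
  coding_precedes : forall a b, natural w a -> natural w b ->
    precedes w a b <-> h a < h b;
  coding_equivalent : forall a b, natural w a -> natural w b ->
    equivalent w a b <-> h a = h b }.

Record arith_coding w (h : dom Fr -> nat) : Prop := ArithCoding {
  arith_order_coding :> order_coding w h;
  coding_addition : forall a b c, natural w a -> natural w b -> natural w c ->
    addition w a b c <-> h a + h b = h c;
  coding_multiplication : forall a b c, natural w a -> natural w b -> natural w c ->
    multiplication w a b c <-> h a * h b = h c }.

Lemma coding_initial w h a :
  order_coding w h -> natural w a -> initial w a <-> h a = 0.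
Proof.
move=> H Na; split=> [[_ no]|ha].
  case: (posnP (h a)) => // ha; case: no; have [b Nb hb] := coding_surj H 0.
  by exists b; [case: Nb|apply/(coding_precedes H) => //; rewrite hb].
split=> [|[b db ba]]; first by case: Na.
have Nb : natural w b by case: ba.
by move: ba => /(coding_precedes H Nb Na); rewrite ha.
Qed.

Lemma coding_successor w h a b : order_coding w h ->
  natural w a -> natural w b -> successor w a b <-> h b = (h a).+1.
Proof.
move=> H Na Nb; split=> [[/(coding_precedes H Na Nb) ab no]|hb].
  (* If [h b] exceeded [(h a).+1], an individual with that code would lie strictly between [a] and
     [b]. *)
  apply/eqP; rewrite eqn_leq ab andbT leqNgt; apply/negP => lt.
  apply: no; have [c Nc hc] := coding_surj H (h a).+1.
  exists c; first by case: Nc.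
  by split; apply/(coding_precedes H) => //; rewrite hc.
split=> [|[c dc [ac cb]]]; first by apply/(coding_precedes H) => //; rewrite hb.
have Nc : natural w c by case: cb.
move: ac cb => /(coding_precedes H Na Nc) ac /(coding_precedes H Nc Nb).
by rewrite hb ltnS leqNgt ac.
Qed.

(** * Correctness of the translation under a coding *)

Definition represents w h g (v : var -> nat) (s : seq var) : Prop :=
  forall x, x \in s -> natural w (g x) /\ h (g x) = v x.

Lemma represents_sub w h g v s t :
  {subset t <= s} -> represents w h g v s -> represents w h g v t.
Proof. by move=> ts H x /ts/H. Qed.

Lemma represents_fresh w h g v s t a : {subset t <= s} ->
  represents w h g v t -> represents w h (update g (fresh s) a) v t.
Proof. by move=> ts H x xt; rewrite update_fresh ?ts//; exact: H. Qed.

(** Common core of the clauses for sums, products and [<], where two fresh variables receive the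
    values of the subterms. Correctness for [t1] and [t2] is a hypothesis, so that the induction on
    terms can supply it; [s] may contain further variables to be avoided, such as the target of an
    equation. *)
Lemma sat_ex_values w h v s t1 t2 p g (u1 := fresh s) (u2 := fresh (u1 :: s)) :
  order_coding w h ->
  {subset tvars t1 ++ tvars t2 <= s} ->
  (forall y g, represents w h g v (tvars t1) -> natural w (g y) ->
     sat I (eq_var_star t1 y) w g <-> teval v t1 = h (g y)) ->
  (forall y g, represents w h g v (tvars t2) -> natural w (g y) ->
     sat I (eq_var_star t2 y) w g <-> teval v t2 = h (g y)) ->
  represents w h g v (tvars t1 ++ tvars t2) ->
  sat I (FEx u1 (FEx u2 (FAnd (Nf u1) (FAnd (Nf u2)
    (FAnd (eq_var_star t1 u1) (FAnd (eq_var_star t2 u2) p)))))) w g <->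
  exists a b, [/\ natural w a, natural w b, h a = teval v t1, h b = teval v t2
                & sat I p w (update (update g u1 a) u2 b)].
Proof.
move=> H sub IH1 IH2 repr.
have repr2 a b t : {subset t <= tvars t1 ++ tvars t2} ->
    represents w h (update (update g u1 a) u2 b) v t.
  move=> tsub; apply: represents_fresh.
    by move=> x /tsub/sub; rewrite inE orbC => ->.
  by apply: represents_fresh; [move=> x /tsub/sub|exact: represents_sub repr].
have sub1 : {subset tvars t1 <= tvars t1 ++ tvars t2}.
  by move=> x; rewrite mem_cat => ->.
have sub2 : {subset tvars t2 <= tvars t1 ++ tvars t2}.
  by move=> x; rewrite mem_cat orbC => ->.
have val1 a b : update (update g u1 a) u2 b u1 = a.
  by rewrite update_fresh ?mem_head// update_same.
have eq1 a b : natural w a -> sat I (eq_var_star t1 u1) w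
    (update (update g u1 a) u2 b) <-> teval v t1 = h a.
  by move=> Na; have := IH1 u1 _ (repr2 a b _ sub1); rewrite val1; apply.
have eq2 a b : natural w b -> sat I (eq_var_star t2 u2) w
    (update (update g u1 a) u2 b) <-> teval v t2 = h b.
  by move=> Nb; have := IH2 u2 _ (repr2 a b _ sub2); rewrite update_same; apply.
split.
  rewrite sat_FEx => -[a da]; rewrite sat_FEx => -[b db].
  rewrite !sat_FAnd !sat_Nf val1 update_same => -[pa [pb [E1 [E2 sp]]]].
  by exists a, b; split=> //; symmetry; [apply/(eq1 a b)|apply/(eq2 a b)].
move=> [a [b [Na Nb ha hb sp]]].
rewrite sat_FEx; exists a; first by case: Na.
rewrite sat_FEx; exists b; first by case: Nb.
rewrite !sat_FAnd !sat_Nf val1 update_same; split; first by case: Na.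
split; first by case: Nb.
by split; [apply/eq1|split=> //; apply/eq2].
Qed.

(** Induction on [t] for all [y] and [g] at once, since subterms are evaluated at fresh variables
    under updated assignments. Surjectivity of the coding yields witnesses for their values. *)
Lemma sat_eq_var_star w h v t y g : arith_coding w h ->
  represents w h g v (tvars t) -> natural w (g y) ->
  sat I (eq_var_star t y) w g <-> teval v t = h (g y).
Proof.
move=> H; elim: t y g => [x||t IH|t1 IH1 t2 IH2|t1 IH1 t2 IH2] y g repr Ny; cbn [eq_var_star teval].
- rewrite sat_Eqf; have [Nx <-] := repr x (mem_head _ _).
  exact: (coding_equivalent H).
- by rewrite sat_Zf (coding_initial H)//; split.
- set u := fresh _.
  have repr' a : represents w h (update g u a) v (tvars t).
    by apply: represents_fresh => // x xt; rewrite inE xt orbT.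
  split.
    rewrite satE => -[a da]; rewrite !satE update_same update_fresh ?mem_head//.
    move=> [pa [E S]]; have Na : natural w a by split.
    move: S => /(coding_successor H Na Ny) ->.
    by move/(IH _ _ (repr' a)): E; rewrite update_same => ->.
  move=> E; have [a Na ha] := coding_surj H (teval v t).
  rewrite satE; exists a; first by case: Na.
  rewrite !satE update_same update_fresh ?mem_head//; split; first by case: Na.
  split; first by apply/IH; rewrite ?update_same.
  by apply/(coding_successor H) => //; rewrite ha.
- have sub : {subset tvars t1 ++ tvars t2 <= y :: tvars t1 ++ tvars t2}.
    by move=> x; rewrite [x \in _ :: _]inE orbC => ->.
  rewrite (sat_ex_values _ H sub IH1 IH2 repr).
  split=> [[a [b [Na Nb ha hb]]]|E].
    rewrite sat_Af update_same update_fresh ?mem_head// update_same.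
    rewrite update_fresh ?inE ?eqxx ?orbT// update_fresh ?mem_head//.
    by move/(coding_addition H Na Nb Ny); rewrite ha hb.
  have [[a Na ha] [b Nb hb]] := (coding_surj H (teval v t1), coding_surj H (teval v t2)).
  exists a, b; split=> //.
  rewrite sat_Af update_same update_fresh ?mem_head// update_same.
  rewrite update_fresh ?inE ?eqxx ?orbT// update_fresh ?mem_head//.
  by apply/(coding_addition H) => //; rewrite ha hb.
- have sub : {subset tvars t1 ++ tvars t2 <= y :: tvars t1 ++ tvars t2}.
    by move=> x; rewrite [x \in _ :: _]inE orbC => ->.
  rewrite (sat_ex_values _ H sub IH1 IH2 repr).
  split=> [[a [b [Na Nb ha hb]]]|E].
    rewrite sat_Mf update_same update_fresh ?mem_head// update_same.
    rewrite update_fresh ?inE ?eqxx ?orbT// update_fresh ?mem_head//.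
    by move/(coding_multiplication H Na Nb Ny); rewrite ha hb.
  have [[a Na ha] [b Nb hb]] := (coding_surj H (teval v t1), coding_surj H (teval v t2)).
  exists a, b; split=> //.
  rewrite sat_Mf update_same update_fresh ?mem_head// update_same.
  rewrite update_fresh ?inE ?eqxx ?orbT// update_fresh ?mem_head//.
  by apply/(coding_multiplication H) => //; rewrite ha hb.
Qed.

Lemma sat_eq_star w h v t1 t2 g : arith_coding w h ->
  represents w h g v (tvars t1 ++ tvars t2) ->
  sat I (eq_star t1 t2) w g <-> teval v t1 = teval v t2.
Proof.
move=> H repr.
have sub1 : {subset tvars t1 <= tvars t1 ++ tvars t2}.
  by move=> x; rewrite mem_cat => ->.
have sub2 : {subset tvars t2 <= tvars t1 ++ tvars t2}.
  by move=> x; rewrite mem_cat orbC => ->.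
have general (u := fresh (tvars t1 ++ tvars t2)) :
    sat I (FEx u (FAnd (Nf u) (FAnd (eq_var_star t1 u) (eq_var_star t2 u)))) w g <->
    teval v t1 = teval v t2.
  have repr1 a : represents w h (update g u a) v (tvars t1).
    by apply: represents_fresh => //; exact: represents_sub repr.
  have repr2 a : represents w h (update g u a) v (tvars t2).
    by apply: represents_fresh => //; exact: represents_sub repr.
  split.
    rewrite satE => -[a da]; rewrite !sat_FAnd sat_Nf update_same => -[pa [E1 E2]].
    have Na : natural w (update g u a u) by rewrite update_same.
    by move: E1 E2 => /(sat_eq_var_star H (repr1 a) Na) -> /(sat_eq_var_star H (repr2 a) Na) ->.
  move=> E; have [a Na ha] := coding_surj H (teval v t1).
  rewrite satE; exists a; first by case: Na.
  rewrite !sat_FAnd sat_Nf update_same; split; first by case: Na.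
  by split; apply/(sat_eq_var_star H); rewrite ?update_same// -E.
(* Only for a variable [t2] does [eq_star] introduce no fresh quantifier; [general] settles the
   other shapes. *)
case: t2 repr sub1 sub2 general => //= x repr sub1 sub2 _.
have [|Nx <-] := repr x; first by rewrite mem_cat mem_head orbT.
by apply: (sat_eq_var_star H) => //; exact: represents_sub repr.
Qed.

Lemma sat_lt_star w h v t1 t2 g : arith_coding w h ->
  represents w h g v (tvars t1 ++ tvars t2) ->
  sat I (lt_star t1 t2) w g <-> teval v t1 < teval v t2.
Proof.
move=> H repr; rewrite /lt_star (sat_ex_values _ H _ _ _ repr) //.
- split=> [[a [b [Na Nb <- <-]]]|E].
    rewrite sat_Ltf update_same update_fresh ?mem_head// update_same.
    by move/(coding_precedes H Na Nb).
  have [[a Na ha] [b Nb hb]] := (coding_surj H (teval v t1), coding_surj H (teval v t2)).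
  exists a, b; split=> //.
  rewrite sat_Ltf update_same update_fresh ?mem_head// update_same.
  by apply/(coding_precedes H) => //; rewrite ha hb.
- by move=> y g' r Ny; exact: (sat_eq_var_star H).
- by move=> y g' r Ny; exact: (sat_eq_var_star H).
Qed.

Lemma sat_star w h v alpha g : arith_coding w h ->
  represents w h g v (free_vars alpha) -> sat I (star alpha) w g <-> asat v alpha.
Proof.
move=> H; elim: alpha v g => [t1 t2|t1 t2|b IHb|b IHb c IHc|x b IHb] v g repr; cbn [star asat].
- exact: (sat_eq_star H).
- exact: (sat_lt_star H).
- by rewrite sat_FNeg (IHb v).
- rewrite sat_FImp (IHb v) ?(IHc v)//; apply: represents_sub repr => y.
    by rewrite mem_cat orbC => ->.
  by rewrite mem_cat => ->.
- have repr' a n : natural w a -> h a = n ->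
      represents w h (update g x a) (update v x n) (free_vars b).
    move=> Na ha y yb; rewrite /update; case: eqVneq => // yx.
    by apply: repr; rewrite /= mem_filter yx.
  (* A number [n] is matched with an individual of code [n], a natural individual [a] with the
     number [h a]. *)
  split=> [sb n|sb]; last apply: sat_FAllI => a da.
    have [a Na ha] := coding_surj H n; apply/(IHb _ _ (repr' a n Na ha)).
    case: (Na) => da pa; have := sat_FAllE da sb.
    by rewrite sat_FImp sat_Nf update_same; apply.
  rewrite -/(sat I _ w (update g x a)) sat_FImp sat_Nf update_same => pa.
  by apply/(IHb _ _ (repr' a (h a) (conj da pa) erefl)).
Qed.

End Semantics.

(** * The axioms at a single world *)

Section ArithmeticAtWorld.
Variables (Fr : selection_frame) (I : interpretation Fr) (w : world Fr).
Variable g : var -> dom Fr.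
Local Notation natural := (natural I w).
Local Notation equivalent := (equivalent I w).
Local Notation successor := (successor I w).
Local Notation addition := (addition I w).
Local Notation multiplication := (multiplication I w).
Local Notation initial := (initial I w).

Lemma sat_Ax1 : sat I Ax1 w g -> natural !=set0.
Proof. by rewrite /Ax1 !satE => -[a da]; rewrite satE => pa; exists a. Qed.

Lemma sat_Ax2 a : sat I Ax2 w g -> natural a -> exists2 b, natural b & successor a b.
Proof.
move=> H [da pa]; move: (sat_FAllE da H); rewrite !satE.
move=> /(_ pa) [b db]; rewrite satE /update /= => ab; exists b => //.
exact: natural_successor ab.
Qed.

Lemma sat_Ax3 a : sat I Ax3 w g -> natural a -> ~ initial a ->
  exists2 b, natural b & successor b a.
Proof.
move=> H [da pa] na; move: (sat_FAllE da H); rewrite !satE.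
move=> /(_ (conj pa na)) [b db]; rewrite satE /update /= => ba; exists b => //.
by split=> //; case: ba => -[].
Qed.

Lemma sat_Ax4 a1 a2 a3 b1 b2 b3 : sat I Ax4 w g ->
  ldom w a1 -> ldom w a2 -> ldom w a3 -> ldom w b1 -> ldom w b2 -> ldom w b3 ->
  equivalent a1 b1 -> equivalent a2 b2 -> equivalent a3 b3 ->
  (addition a1 a2 a3 <-> addition b1 b2 b3) /\
  (multiplication a1 a2 a3 <-> multiplication b1 b2 b3).
Proof.
move=> H d1 d2 d3 e1 e2 e3 E1 E2 E3.
move: H => /(sat_FAllE d1)/(sat_FAllE d2)/(sat_FAllE d3).
move=> /(sat_FAllE e1)/(sat_FAllE e2)/(sat_FAllE e3).
by rewrite !satE /update /=; apply.
Qed.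

Lemma sat_Ax5 a b c c' : sat I Ax5 w g ->
  ldom w a -> ldom w b -> ldom w c -> ldom w c' ->
  (addition a b c /\ addition a b c' -> equivalent c c') /\
  (multiplication a b c /\ multiplication a b c' -> equivalent c c').
Proof.
move=> H da db dc dc'.
move: H => /(sat_FAllE da)/(sat_FAllE db)/(sat_FAllE dc)/(sat_FAllE dc').
by rewrite !satE /update /=.
Qed.

Lemma sat_Ax6 a b : sat I Ax6 w g -> natural a -> ldom w b -> initial b ->
  addition a b a /\ multiplication a b b.
Proof.
move=> H [da pa] db ib; move: H => /(sat_FAllE da)/(sat_FAllE db).
by rewrite !satE /update /=; apply.
Qed.

Lemma sat_Ax7 a b b' c c' : sat I Ax7 w g ->
  ldom w a -> ldom w b -> ldom w b' -> ldom w c -> ldom w c' ->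
  successor b b' -> successor c c' -> addition a b c -> addition a b' c'.
Proof.
move=> H da db db' dc dc' bb' cc'.
move: H => /(sat_FAllE da)/(sat_FAllE db)/(sat_FAllE db')/(sat_FAllE dc)/(sat_FAllE dc').
by rewrite !satE /update /=; apply.
Qed.

Lemma sat_Ax8 a b b' c d : sat I Ax8 w g ->
  ldom w a -> ldom w b -> ldom w b' -> ldom w c -> ldom w d ->
  successor b b' -> addition c a d -> multiplication a b c -> multiplication a b' d.
Proof.
move=> H da db db' dc dd bb' cad.
move: H => /(sat_FAllE da)/(sat_FAllE db)/(sat_FAllE db')/(sat_FAllE dc)/(sat_FAllE dd).
by rewrite !satE /update /=; apply.
Qed.

(** Ax6 with Ax7 and Ax8 is the recursion for sum and product, so by induction the predicates hold
    of all correct triples; Ax5 excludes every other value. *)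
Lemma order_coding_arith h :
  order_coding I w h -> sat I AX w g -> arith_coding I w h.
Proof.
move=> H; rewrite /AX !(sat_FAnd _ _ _ w g) => -[_ [_ [_ [A4 [A5 [A6 [A7 A8]]]]]]].
have sub a : natural a -> ldom w a by case.
have initialP a : natural a -> h a = 0 -> initial a by move=> Na; exact: (coding_initial H Na).2.
have successorP a b : natural a -> natural b -> h b = (h a).+1 -> successor a b.
  by move=> Na Nb; exact: (coding_successor H Na Nb).2.
have equivalentP a b : natural a -> natural b -> h a = h b -> equivalent a b.
  by move=> Na Nb; exact: (coding_equivalent H Na Nb).2.
have add_graph a b c : natural a -> natural b -> natural c ->
    h a + h b = h c -> addition a b c.
  (* The induction is on the code of [b], with [b] and [c] arbitrary individuals of the required
     codes. *)
  move=> Na; move: {2}(h b) (erefl (h b)) => n.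
  elim: n b c => [|n IHn] b c hb Nb Nc; rewrite hb.
    rewrite addn0 => ac; have [aba _] := sat_Ax6 A6 Na (sub _ Nb) (initialP _ Nb hb).
    (* Ax6 gives the sum [a] itself; Ax4 passes to [c], possibly another individual with the same
       code. *)
    have [|||E _] := sat_Ax4 A4 (sub _ Na) (sub _ Nb) (sub _ Na) (sub _ Na) (sub _ Nb) (sub _ Nc).
    - exact: equivalentP.
    - exact: equivalentP.
    - exact: equivalentP.
    - exact/E.
  rewrite addnS => hc.
  have [b' Nb' hb'] := coding_surj H n; have [c' Nc' hc'] := coding_surj H (h a + n).
  apply: (sat_Ax7 A7 (b := b') (c := c')); try exact: sub.
  - by apply: successorP => //; rewrite hb hb'.
  - by apply: successorP => //; rewrite -hc hc'.
  - by apply: IHn => //; rewrite hb'.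
have mul_graph a b c : natural a -> natural b -> natural c ->
    h a * h b = h c -> multiplication a b c.
  move=> Na; move: {2}(h b) (erefl (h b)) => n.
  elim: n b c => [|n IHn] b c hb Nb Nc; rewrite hb.
    rewrite muln0 => hc; have [_ abb] := sat_Ax6 A6 Na (sub _ Nb) (initialP _ Nb hb).
    have [|||_ E] := sat_Ax4 A4 (sub _ Na) (sub _ Nb) (sub _ Nb) (sub _ Na) (sub _ Nb) (sub _ Nc).
    - exact: equivalentP.
    - exact: equivalentP.
    - by apply: equivalentP; rewrite ?hb.
    - exact/E.
  rewrite mulnS => hc.
  have [b' Nb' hb'] := coding_surj H n; have [c' Nc' hc'] := coding_surj H (h a * n).
  apply: (sat_Ax8 A8 (b := b') (c := c')); try exact: sub.
  - by apply: successorP => //; rewrite hb hb'.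
  - by apply: add_graph => //; rewrite hc' addnC.
  - by apply: IHn => //; rewrite hb'.
split; [exact: H| |] => a b c Na Nb Nc; split=> [abc|];
  [|exact: add_graph| |exact: mul_graph].
  (* An individual [d] coding the correct sum also satisfies the predicate, so Ax5 makes [c]
     equivalent to it. *)
  have [d Nd hd] := coding_surj H (h a + h b); rewrite -hd.
  apply/(coding_equivalent H) => //.
  have [E _] := sat_Ax5 A5 (sub _ Na) (sub _ Nb) (sub _ Nd) (sub _ Nc).
  by apply: E; split=> //; apply: add_graph.
have [d Nd hd] := coding_surj H (h a * h b); rewrite -hd.
apply/(coding_equivalent H) => //.
have [_ E] := sat_Ax5 A5 (sub _ Na) (sub _ Nb) (sub _ Nd) (sub _ Nc).
by apply: E; split=> //; apply: mul_graph.
Qed.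

(** Each axiom becomes a fact about numbers. As Ax5, for instance, quantifies over the whole local
    domain while a coding speaks of naturals, all its members are assumed natural. *)
Lemma arith_coding_AX h :
  (forall a, ldom w a -> natural a) -> arith_coding I w h -> sat I AX w g.
Proof.
move=> nat H; rewrite /AX !(sat_FAnd _ _ _ w g).
split.
  have [a [da pa] _] := coding_surj H 0.
  by rewrite /Ax1 satE; exists a => //; rewrite satE.
split.
  apply: sat_FAllI => a da; rewrite !satE => _.
  have [b Nb hb] := coding_surj H (h a).+1; exists b; first by case: Nb.
  by rewrite satE /update /=; apply/(coding_successor H) => //; exact: nat.
split.
  apply: sat_FAllI => a da; rewrite !satE; have Na := nat a da.
  move=> [_ na]; case ha: (h a) => [|n]; first by case: na; apply/(coding_initial H).
  have [b Nb hb] := coding_surj H n; exists b; first by case: Nb.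
  by rewrite satE /update /=; apply/(coding_successor H) => //; rewrite ha hb.
split.
  do ?[apply: sat_FAllI => ? /nat ?]; rewrite !satE /update /=.
  move=> [/(coding_equivalent H) e1 [/(coding_equivalent H) e2 /(coding_equivalent H) e3]].
  rewrite !(coding_addition H)// !(coding_multiplication H)//.
  by rewrite e1// e2// e3.
split.
  do ?[apply: sat_FAllI => ? /nat ?]; rewrite !satE /update /=.
  rewrite !(coding_addition H)// !(coding_multiplication H)//.
  by split=> -[e1 e2]; apply/(coding_equivalent H) => //; rewrite -e1 -e2.
split.
  do ?[apply: sat_FAllI => ? /nat ?]; rewrite !satE /update /=.
  move=> [_ /(coding_initial H) b0].
  rewrite !(coding_addition H)// !(coding_multiplication H)//.
  by rewrite b0// addn0 muln0.
split.
  do ?[apply: sat_FAllI => ? /nat ?]; rewrite !satE /update /=.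
  move=> [/(coding_successor H) e1 /(coding_successor H) e2].
  rewrite !(coding_addition H)// e1// e2// => <-.
  by rewrite addnS.
do ?[apply: sat_FAllI => ? /nat ?]; rewrite !satE /update /=.
move=> [/(coding_successor H) e1].
rewrite !(coding_addition H)// !(coding_multiplication H)// e1// => <- <-.
by rewrite mulnS addnC.
Qed.

End ArithmeticAtWorld.

(** * The preorder induced by a weakly Stalnakerian selection *)

Section WeaklyStalnakerian.
Variables (Fr : selection_frame) (I : interpretation Fr) (w : world Fr).
Hypothesis ws : weakly_stalnakerian Fr.
Implicit Types (P Q : set (world Fr)) (a b c : dom Fr).
Local Notation ext := (ext I).
Local Notation possible := (possible I w).
Local Notation natural := (natural I w).

Lemma sel_unique P u v : sel P w u -> sel P w v -> u = v.
Proof. by have [_ _ _] := ws P P w; apply. Qed.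

Lemma sel_sub P : sel P w `<=` P.
Proof. by have [] := ws P P w. Qed.

(** By uniqueness the selection from [P] is just [u], hence included in [Q]; the selection from [Q]
    lies in [P], so the third frame condition identifies the two. *)
Lemma sel_restrict P Q u : Q `<=` P -> sel P w u -> Q u -> sel Q w u.
Proof.
move=> QP Pu Qu; have [_ _ cso _] := ws P Q w.
rewrite -cso// => [v /(sel_unique Pu) <- //|].
by move=> v /sel_sub/QP.
Qed.

(** An empty selection from [P] would be included in [Q] vacuously, so the third frame condition
    would make the selection from [Q] empty too. *)
Lemma sel_nonempty P Q : Q `<=` P -> sel Q w !=set0 -> sel P w !=set0.
Proof.
move=> QP [u Qu]; apply: contrapT => P0; have [_ _ cso _] := ws P Q w.
apply: (P0); exists u; rewrite cso// => [v Pv|v /sel_sub/QP //].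
by case: P0; exists v.
Qed.

(** Existence rather than inclusion, so that an empty selection does not count; if [a] or [b] is
    possible, the union does select a world. *)
Definition weakly_precedes a b : Prop :=
  exists2 u, sel (ext a `|` ext b) w u & ext a u.

Lemma weakly_precedes_total a b :
  possible a -> weakly_precedes a b \/ weakly_precedes b a.
Proof.
move=> pa; have [u su] := sel_nonempty (@subsetUl _ (ext a) (ext b)) pa.
by have [au|bu] := sel_sub su; [left|right]; exists u => //; rewrite setUC.
Qed.

Lemma weakly_precedes_trans b a c : possible a ->
  weakly_precedes a b -> weakly_precedes b c -> weakly_precedes a c.
Proof.
move=> pa [u abu au] [v bcv bv].
pose U := ext a `|` ext b `|` ext c.
have abU : ext a `|` ext b `<=` U by move=> x; left.
have bcU : ext b `|` ext c `<=` U by move=> x [bx|cx]; [left; right|right].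
have acU : ext a `|` ext c `<=` U by move=> x [ax|cx]; [left; left|right].
have aU : ext a `<=` U by move=> x ax; left; left.
(* The world [t] selected from all three extensions stays selected in each pairwise union containing
   it. Hence if it lies in [ext c] it lies in [ext b], and if in [ext b] then in [ext a]. *)
have [t Ut] := sel_nonempty aU pa.
have bt_at : ext b t -> ext a t.
  move=> bt; have abt := sel_restrict abU Ut (or_intror bt).
  by rewrite -(sel_unique abu abt).
have a_t : ext a t.
  have [[//|/bt_at//]|ct] := sel_sub Ut.
  apply: bt_at; have bct := sel_restrict bcU Ut (or_intror ct).
  by rewrite -(sel_unique bcv bct).
by exists t => //; apply: sel_restrict Ut _ => //; left.
Qed.

(* The world selected by the union of all extensions of members of [Y] lies in the extension
   of a least member. *)
Lemma weakly_precedes_wf (Y : set (dom Fr)) :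
  (forall a, Y a -> possible a) -> Y !=set0 ->
  exists2 a, Y a & forall b, Y b -> weakly_precedes a b.
Proof.
move=> pY [c Yc]; pose U := \bigcup_(a in Y) ext a.
have extU a : Y a -> ext a `<=` U by move=> Ya u au; exists a.
have [u Uu] := sel_nonempty (extU c Yc) (pY c Yc).
have [a Ya au] := sel_sub Uu; exists a => // b Yb; exists u => //.
by apply: sel_restrict Uu _; [rewrite subUset; split; exact: extU|left].
Qed.

Lemma precedesE a b : possible a -> possible b ->
  precedes I w a b <-> ~ weakly_precedes b a.
Proof.
rewrite /weakly_precedes setUC => pa pb; split=> [[_ _ ab] [u /ab //]|nba].
by split=> // u su bu; apply: nba; exists u.
Qed.

(** The world selected from the union is unique, so it lies in both extensions exactly when it
    witnesses both directions. *)
Lemma equivalentE a b : possible a -> possible b ->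
  equivalent I w a b <-> weakly_precedes a b /\ weakly_precedes b a.
Proof.
move=> pa pb; split=> [[_ _ ab]|[[u abu au] [v]]].
  have [u su] := sel_nonempty (@subsetUl _ (ext a) (ext b)) pa.
  by have [au bu] := ab u su; split; exists u => //; rewrite setUC.
rewrite setUC => abv bv; split=> // x abx; split.
  by rewrite -(sel_unique abu abx).
by rewrite -(sel_unique abv abx).
Qed.

Lemma successorE a b : natural a -> natural b ->
  successor I w a b <-> immediate_succ natural weakly_precedes a b.
Proof.
move=> [da pa] [db pb]; rewrite /successor precedesE//.
split=> -[nba no]; split=> // -[c Nc [ac cb]]; apply: no.
  case: Nc => dc pc; exists c => //.
  by rewrite !precedesE.
have pc : possible c by case: ac.
by exists c => //; rewrite -!precedesE.
Qed.

(** The selection function provides totality, transitivity and least elements for [omega_rank]; Ax1,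
    Ax2 and Ax3 provide nonemptiness, successors and predecessors. *)
Lemma AX_order_coding g : sat I AX w g -> exists h, order_coding I w h.
Proof.
rewrite /AX !(sat_FAnd _ _ _ w g) => -[A1 [A2 [A3 _]]].
have [||||||h [h_surj hP]] := @omega_rank _ natural weakly_precedes.
- by move=> a b [_ pa] _; exact: weakly_precedes_total.
- by move=> b a c [_ pa] _ _; exact: weakly_precedes_trans.
- move=> Y YN; apply: weakly_precedes_wf => a /YN[] //.
- exact: sat_Ax1 A1.
- move=> a Na; have [b Nb ab] := sat_Ax2 A2 Na; exists b => //.
  by apply/successorE.
- move=> a Na [b Nb nab].
  (* [b] strictly precedes [a], so [a] is not initial and Ax3 applies. *)
  have [|c Nc ca] := sat_Ax3 A3 Na; last by exists c => //; apply/successorE.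
  case: (Na) (Nb) => [_ pa] [db pb] [_ no]; apply: no; exists b => //.
  exact/precedesE.
exists h; split=> // a b Na Nb; case: (Na) (Nb) => [_ pa] [_ pb].
  by rewrite precedesE// hP// ltnNge; split=> /negP.
rewrite equivalentE// !hP//; split=> [[ab ba]|->//].
by apply/eqP; rewrite eqn_leq ab.
Qed.

End WeaklyStalnakerian.

(** * The standard frame and model *)

Definition least (P : set nat) : set nat :=
  [set n | P n /\ forall m, P m -> n <= m].

Definition standard_sel (P : set nat) (w : nat) : set nat :=
  [set n | (P w /\ n = w) \/ (~ P w /\ least P n)].

Definition standard_frame : selection_frame :=
  @SelectionFrame nat (fun _ _ => True) standard_sel nat (fun _ => setT)
    (inhabits 0) (inhabits 0) (fun _ _ _ _ => I).

Lemma least_exists (P : set nat) : P !=set0 -> least P !=set0.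
Proof.
case=> n Pn; have exP : exists n, `[< P n >] by exists n; apply/asboolP.
have [m /asboolP Pm mP] := ex_minnP exP.
by exists m; split=> // k Pk; apply: mP; apply/asboolP.
Qed.

Lemma least_unique (P : set nat) : is_subset1 (least P).
Proof.
by move=> m n [Pm mP] [Pn nP]; apply/eqP; rewrite eqn_leq mP// nP.
Qed.

Lemma standard_selT (P : set nat) w : P w -> standard_sel P w = [set w].
Proof. by move=> Pw; apply/seteqP; split=> n; [case=> -[]|left]. Qed.

Lemma standard_selN (P : set nat) w : ~ P w -> standard_sel P w = least P.
Proof. by move=> nPw; apply/seteqP; split=> n; [case=> -[]|right]. Qed.

Lemma standard_frame_ws : weakly_stalnakerian standard_frame.
Proof.
have subP P w : standard_sel P w `<=` P by move=> n [[Pw ->]|[_ []]].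
have inP P w : P w -> standard_sel P w w by left.
move=> P Q w; split.
- exact: subP.
- exact: inP.
(* Under the two inclusions either both propositions contain [w], and both select it, or neither
   does, and both select their least element. *)
- rewrite /= => PQ QP; have [Pw|nPw] := pselect (P w).
    by rewrite !standard_selT//; apply: PQ; exact: inP.
  have nQw : ~ Q w by move/(inP Q w)/QP.
  move: PQ QP; rewrite !standard_selN// => PQ QP.
  (* The least element of [B] lies in [A], so a least element of [A] is below it and hence below all
     of [B]. *)
  have half (A B : set nat) : least A `<=` B -> least B `<=` A -> least A `<=` least B.
    move=> AB BA n An; split; first exact: AB.
    move=> m Bm; have [k Bk] : least B !=set0 by apply: least_exists; exists m.
    case: (An) => _ nP; apply: leq_trans (nP k (BA k Bk)) _; case: Bk => _; exact.
  by apply/seteqP; split; exact: half.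
- rewrite /=; have [Pw|nPw] := pselect (P w); last by rewrite standard_selN//; exact: least_unique.
  by rewrite standard_selT// => m n -> ->.
Qed.

(** A monadic predicate holds of [n] at world [n] only, which makes [ext n] a singleton. The 3-place
    predicates are the graphs of addition (index 0) and multiplication, the same at every world. *)
Definition standard_interp : interpretation standard_frame :=
  fun n i w => match n return set (n.-tuple nat) with
  | 1 => [set t | thead t = w]
  | 3 => [set t | let x := nth 0 t in
                  if i == 0 then x 0 + x 1 = x 2 else x 0 * x 1 = x 2]
  | _ => set0
  end.

Lemma standard_ext a : ext standard_interp a = [set a].
Proof. by apply/funext => u; rewrite /ext /= theadE; apply/propext; split. Qed.

(** At world 0 centering agrees with minimality: if 0 belongs to [P], it is also its least
    element. *)
Lemma standard_sel0 (P : set nat) : standard_sel P 0 = least P.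
Proof.
have [P0|nP0] := pselect (P 0); last by rewrite standard_selN.
rewrite standard_selT//; apply/seteqP; split=> [n ->|n [_ /(_ 0 P0)]]; first by [].
by rewrite leqn0 => /eqP.
Qed.

Lemma standard_least a b : least ([set a] `|` [set b]) = [set minn a b].
Proof.
have leastm : least ([set a] `|` [set b]) (minn a b).
  split; first by rewrite /minn; case: ifP => _; [left|right].
  by move=> m [->|->]; rewrite ?geq_minl ?geq_minr.
by apply/seteqP; split=> [n /(least_unique leastm) <- //|n ->].
Qed.

Lemma standard_possible a : possible standard_interp (0 : world standard_frame) a.
Proof.
rewrite /possible standard_ext /= standard_sel0.
by apply: least_exists; exists a.
Qed.

Lemma standard_natural a : natural standard_interp (0 : world standard_frame) a.
Proof. by split=> //; exact: standard_possible. Qed.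

Lemma standard_coding : arith_coding standard_interp (0 : world standard_frame) id.
Proof.
have seL a b : sel (ext standard_interp a `|` ext standard_interp b)
    (0 : world standard_frame) = [set minn a b].
  by rewrite !standard_ext /= standard_sel0 standard_least.
split; first split.
- by move=> n; exists n => //; exact: standard_natural.
- move=> a b _ _; split=> [[_ _]|ab].
    rewrite seL standard_ext => /(_ _ erefl) /= nab; rewrite ltnNge; apply/negP => ba.
    by apply: nab; apply/minn_idPr.
  split; [exact: standard_possible|exact: standard_possible|].
  rewrite seL standard_ext => _ -> /= e; move: ab.
  by rewrite -e ltnNge geq_minl.
- move=> a b _ _; split=> [[_ _]|->].
    by rewrite seL !standard_ext => /(_ _ erefl) /= [-> <-].
  split; [exact: standard_possible|exact: standard_possible|].
  by rewrite seL !standard_ext minnn => _ ->.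
- by [].
- by [].
Qed.

(** * Truth in the standard model and validity *)

Lemma valid_star_true alpha :
  logic weakly_stalnakerian (FImp AX (star alpha)) -> true_in_N alpha.
Proof.
move=> H g; have AXg : sat standard_interp AX (0 : world standard_frame) g.
  by apply: (arith_coding_AX _ standard_coding) => a _; exact: standard_natural.
(* Every individual is natural and codes itself, so [g] serves both as assignment and as valuation,
   also when [alpha] is open. *)
have repr : represents standard_interp (0 : world standard_frame) id g g (free_vars alpha).
  by move=> x _; split=> //; exact: standard_natural.
by apply: (sat_star standard_coding repr).1; exact: (H _ standard_frame_ws).
Qed.

Lemma true_sentence_valid alpha : sentence alpha -> true_in_N alpha ->
  logic weakly_stalnakerian (FImp AX (star alpha)).
Proof.
move=> closed true_alpha Fr ws I w g AXw.
have [h Hh] := AX_order_coding ws AXw; have H := order_coding_arith Hh AXw.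
(* The valuation is arbitrary, as a sentence has no free variables to represent. *)
apply/(sat_star H (v := fun=> 0)); last exact: true_alpha.
by move=> x; rewrite closed.
Qed.

Lemma universal_closure_sentence alpha : sentence (universal_closure alpha).
Proof.
rewrite /sentence /universal_closure.
have -> s : free_vars (foldr AAll alpha s) = [seq y <- free_vars alpha | y \notin s].
  elim: s => /= [|x s ->]; first by rewrite filter_predT.
  by rewrite -filter_predI; apply: eq_filter => y /=; rewrite inE negb_or.
by apply/eqP; rewrite -size_eq0 size_filter -leqn0 leqNgt -has_count; apply/hasPn => x;
  rewrite mem_undup negbK.
Qed.

Lemma true_universal_closure alpha : true_in_N (universal_closure alpha) <-> true_in_N alpha.
Proof.
rewrite /universal_closure; elim: (undup _) => //= x s <-.
split=> H g; last by move=> n; exact: H.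
(* The added quantifier is instantiated with the value that [g] already gives to [x]. *)
suff <- : update g x (g x) = g by exact: H.
by apply/funext => y; rewrite /update; case: eqP => // ->.
Qed.

Theorem theorem1 (alpha : aformula) :
  [/\ true_in_N alpha <->
        logic weakly_stalnakerian (FImp AX (star (universal_closure alpha))),
      sentence alpha ->
        (true_in_N alpha <-> logic weakly_stalnakerian (FImp AX (star alpha)))
    & logic weakly_stalnakerian (FImp AX (star alpha)) -> true_in_N alpha].
Proof.
split; last exact: valid_star_true.
- split=> [/true_universal_closure|/valid_star_true/true_universal_closure //].
  exact: true_sentence_valid (universal_closure_sentence alpha).
- by move=> closed; split; [exact: true_sentence_valid|exact: valid_star_true].
Qed.
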